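(* Let $\tau$ be a complex number with $\mathrm{Im}(\tau)>0$ and let $q=e^{\pi i\tau}$. For every integer $m>1$, \[ \prod_{k=1}^{2^{m-1}}\Gamma_q\Big(\frac{2k-1}{2^m}\Big) = (1-q)^{2^{m-2}}\, \psi\big(q^{\frac{1}{2^{m}}}\big) \prod_{k=1}^{m-1} \psi^{2^{m-1-k}}\big(q^{\frac{1}{2^{k}}}\big). \] (The left-hand side is the product of $\Gamma_q(k/2^m)$ over $1\le k\le 2^m$ with $\gcd(k,2^m)=1$.)
   Context: For a complex number $a$ and $|p|<1$, $(a;p)_\infty=\prod_{i=0}^{\infty}(1-ap^i)$. Fractional powers of $q$ are defined via $\tau$: $q^{c}=e^{\pi i\tau c}$ for real $c$. The $q$-gamma function is $\Gamma_q(z)=\dfrac{(q;q)_\infty}{(q^{z};q)_\infty}(1-q)^{1-z}$, with the principal branch for $(1-q)^{1-z}$. Ramanujan's theta function is $\psi(p)=\dfrac{(p^2;p^2)_\infty}{(p;p^2)_\infty}$ for $|p|<1$, and $\psi(q^{c})$ means $\dfrac{(q^{2c};q^{2c})_\infty}{(q^{c};q^{2c})_\infty}$. *)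

(* Defs.v *)
From HB Require Import structures.
From mathcomp Require Import all_boot all_order all_algebra.
From mathcomp Require Export complex.
From mathcomp Require Import all_classical all_reals all_analysis.
Set Implicit Arguments.
Unset Strict Implicit.
Unset Printing Implicit Defensive.
Import Order.TTheory GRing.Theory Num.Theory.
Import numFieldNormedType.Exports.
Local Open Scope ring_scope.
Local Open Scope classical_set_scope.
Local Open Scope complex_scope.

Section ComplexFunctions.
Variable R : realType.
Implicit Types z w : R[i].

Definition cexp z : R[i] :=
  (expR (complex.Re z) * cos (complex.Im z))
    +i* (expR (complex.Re z) * sin (complex.Im z)).

(* Principal argument, in ]-pi, pi] for z != 0; junk value at z = 0. *)
Definition carg z : R :=
  if 0 <= complex.Im z then acos (complex.Re z / ComplexField.Normc.normc z)
  else - acos (complex.Re z / ComplexField.Normc.normc z).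

Definition clog z : R[i] := ln (ComplexField.Normc.normc z) +i* carg z.

(* Principal branch of w ^ z, meaningful for w != 0. *)
Definition cpow w z : R[i] := cexp (z * clog w).

End ComplexFunctions.

Section QFunctions.
Variable R : realType.
Implicit Types a p tau z : R[i].

(* (a; p)_oo. The regular module R[i]^o is where the library puts the topology
   of R[i] given by the modulus. The product converges for |p| < 1. *)
Definition qpoch a p : R[i] :=
  limn (fun n => \prod_(0 <= i < n) (1 - a * p ^+ i) : R[i]^o).

(* q ^ z, where q = e ^ (pi i tau); it depends on tau and not just on q. *)
Definition qpow tau z : R[i] := cexp (pi%:C * 'i * tau * z).

Definition nome tau : R[i] := cexp (pi%:C * 'i * tau).

(* Gamma_q z with q = nome tau. *)
Definition qGamma tau z : R[i] :=
  qpoch (nome tau) (nome tau) / qpoch (qpow tau z) (nome tau)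
    * cpow (1 - nome tau) (1 - z).

(* Ramanujan's theta function psi. *)
Definition rpsi p : R[i] := qpoch (p ^+ 2) (p ^+ 2) / qpoch p (p ^+ 2).

End QFunctions.

(* Main.v *)
(* With q_k = q^(1/2^k) and E_k = (q_k; q_k)_oo, the (2j-1)/2^m-th powers of q are
   the odd powers of q_m, so the denominators of the q-gamma factors assemble to
   (q_m; q_m^2)_oo and the left-hand side is
   (1-q)^(2^(m-2)) E_0^(2^(m-1)) / (q_m; q_m^2)_oo.
   Since psi(q_k) = E_(k-1)^2 / E_k, the product of the psi(q_k)^(2^(m-1-k))
   telescopes to E_0^(2^(m-1)) / E_(m-1), and psi(q_m) = E_(m-1) / (q_m; q_m^2)_oo. *)
Require Import Defs.
From mathcomp Require Import all_boot all_order all_algebra.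
From mathcomp Require Import all_classical all_reals all_analysis.
From mathcomp Require Import ring lra.
Import Order.TTheory GRing.Theory Num.Theory numFieldNormedType.Exports.
Local Open Scope ring_scope.
Local Open Scope classical_set_scope.
Local Open Scope complex_scope.
Import ComplexField.Normc.

(** * Series, limits of finite products and telescoping *)

(** Up to [u 0], the sequence is the series of its increments, which converges absolutely by
    comparison with a geometric series. *)
Lemma cvg_geometric_increments (R : realType) (u : R^nat) (c x : R) :
  0 <= x < 1 -> (forall n, `|u n.+1 - u n| <= c * x ^+ n) -> cvgn u.
Proof.
move=> /andP[x0 x1] hu.
have uE : u = (fun n => u 0%N + series (fun k => u k.+1 - u k) n).
  by apply/funext => n; rewrite /series/= telescope_sumr// addrC subrK.
rewrite uE; apply: is_cvgD; first exact: is_cvg_cst.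
apply: normed_cvg; apply: (@series_le_cvg _ _ (geometric c x)) => [n|n|n|] //=.
  exact: le_trans (hu n).
by apply: is_cvg_geometric_series; rewrite ger0_norm.
Qed.

Lemma geometric_sum_le (R : numFieldType) (c y : R) n : 0 <= c -> 0 <= y < 1 ->
  \sum_(0 <= i < n) c * y ^+ i <= c / (1 - y).
Proof.
move=> c0 /andP[y0 y1].
have := @geometric_seriesE _ c y (negbT (lt_eqF y1)).
rewrite /series/= => /(congr1 (fun f => f n)) /= ->.
rewrite ler_pM2r ?invr_gt0 ?subr_gt0// -[leRHS]mulr1 ler_wpM2l//.
by rewrite gerBl exprn_ge0.
Qed.

Lemma cvg_prod (K : numFieldType) (I : Type) (r : seq I) (F : I -> nat -> K) (l : I -> K) :
  (forall i, F i @ \oo --> l i) ->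
  (fun n => \prod_(i <- r) F i n) @ \oo --> \prod_(i <- r) l i.
Proof.
move=> h; elim: r => [|i r IH].
  by rewrite big_nil; under eq_fun do rewrite big_nil; exact: cvg_cst.
by rewrite big_cons; under eq_fun do rewrite big_cons; exact: cvgM.
Qed.

(** From [n] to [n.+1] the old exponents double, and the new factor turns [E n.+1] into [E n ^+ 2],
    so the left-hand side is squared. *)
Lemma square_quotient_telescope (K : fieldType) (E : nat -> K) n :
  (forall k, E k != 0) ->
  E n * \prod_(1 <= k < n.+1) (E k.-1 ^+ 2 / E k) ^+ (2 ^ (n - k))%N = E 0%N ^+ (2 ^ n)%N.
Proof.
move=> E0; elim: n => [|n IH]; first by rewrite big_nil mulr1 expn0 expr1.
rewrite big_nat_recr//= subnn expn0 expr1.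
rewrite mulrC -!mulrA mulVf// mulr1 expnSr exprM -IH exprMn [RHS]mulrC; congr (_ * _).
rewrite -prodrXl; apply: eq_big_nat => k /andP[_ kn].
by rewrite -exprM -expnSr subSn.
Qed.

(** * The complex modulus and convergence by components *)

Section ComplexNorm.
Context {R : realType}.
Implicit Types z w : R[i].

Lemma normE z : `|z| = (normc z)%:C. Proof. by rewrite normc_def; case: z. Qed.

Lemma normc_ge0 z : 0 <= normc z.
Proof. by rewrite -lecR -normE normr_ge0. Qed.

Lemma normc_Re z : `|complex.Re z| <= normc z.
Proof. by rewrite -lecR -normE normc_ge_Re. Qed.

Lemma normc_Im z : `|complex.Im z| <= normc z.
Proof.
by case: z => a b /=; rewrite -sqrtr_sqr ler_wsqrtr// lerDr sqr_ge0.
Qed.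

Lemma normcX z n : normc (z ^+ n) = normc z ^+ n.
Proof.
by elim: n => [|n IH]; rewrite ?expr0 ?normc1// !exprS normcM IH.
Qed.

Lemma normc_expr_lt1 z n : (0 < n)%N -> normc z < 1 -> normc (z ^+ n) < 1.
Proof. by move=> n0 z1; rewrite normcX exprn_ilt1 ?normc_ge0// -lt0n. Qed.

Lemma normc_prod n (F : nat -> R[i]) :
  normc (\prod_(0 <= i < n) F i) = \prod_(0 <= i < n) normc (F i).
Proof.
by elim: n => [|n IH]; rewrite ?big_nil ?normc1// !big_nat_recr//= normcM IH.
Qed.

Lemma normc_1B_le z : normc (1 - z) <= 1 + normc z.
Proof. by rewrite -lecR rmorphD/= -!normE rmorph1 -[X in _ <= X + _]normr1 ler_normB. Qed.

Lemma normc_1B_ge z : 1 - normc z <= normc (1 - z).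
Proof. by rewrite -lecR rmorphB/= -!normE rmorph1 -[X in X - _ <= _]normr1 lerB_dist. Qed.

Lemma cvg_complex (u : nat -> R[i]) :
  cvgn (@complex.Re R \o u) -> cvgn (@complex.Im R \o u) ->
  cvgn (u : nat -> R[i]^o).
Proof.
move=> /cvg_ex[/= a ha] /cvg_ex[/= b hb]; apply/cvg_ex; exists (a +i* b).
apply/cvgrPdist_lt => e e0.
(* A positive element of [R[i]] has zero imaginary part, so the tolerance is a real number. *)
have [d eE d0] : exists2 d : R, e = d%:C & 0 < d.
  by case: e e0 => x y; rewrite ltcE/= => /andP[/eqP-> h]; exists x.
have d20 : 0 < d / 2 by lra.
move/cvgrPdist_lt: ha => /(_ _ d20) ha.
move/cvgrPdist_lt: hb => /(_ _ d20) hb.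
near=> n.
have han : `|a - complex.Re (u n)| < d / 2 by near: n.
have hbn : `|b - complex.Im (u n)| < d / 2 by near: n.
rewrite eE; case: (u n) han hbn => x y /= han hbn.
rewrite [_ - _](_ : _ = (a - x)%:C + (b - y)%:C * 'i); last by simpc.
apply: le_lt_trans (ler_normD _ _) _.
rewrite normrM !normc_def /= !expr0n/= !addr0 add0r expr1n sqrtr1 mulr1 !sqrtr_sqr.
by rewrite -rmorphD/= ltcR; lra.
Unshelve. all: by end_near.
Qed.

End ComplexNorm.

(** * Infinite products: convergence, nonvanishing, splitting *)

Section Qpoch.
Context {R : realType}.
Implicit Types a p : R[i].

Let qprod a p n : R[i] := \prod_(0 <= i < n) (1 - a * p ^+ i).

(** Each factor has modulus at most [1 + x <= expR x] with [x] geometric in [i]; the resulting bound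
    is uniform in [n]. *)
Lemma qprod_le a p n : normc p < 1 ->
  normc (qprod a p n) <= expR (normc a / (1 - normc p)).
Proof.
move=> p1; have y01 : 0 <= normc p < 1 by rewrite normc_ge0.
apply: le_trans (_ : expR (\sum_(0 <= i < n) normc a * normc p ^+ i) <= _); last first.
  by rewrite ler_expR geometric_sum_le ?normc_ge0.
rewrite /qprod normc_prod expR_sum; apply: ler_prod => i _.
rewrite normc_ge0/=; apply: le_trans (normc_1B_le _) _.
by rewrite normcM normcX expR_ge1Dx.
Qed.

(** Consecutive partial products differ by [a * p ^+ n] times a bounded partial product, so the
    geometric criterion applies to the real and imaginary parts. *)
Lemma cvg_qpoch a p : normc p < 1 ->
  (qprod a p : nat -> R[i]^o) @ \oo --> (qpoch a p : R[i]^o).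
Proof.
move=> p1; have y01 : 0 <= normc p < 1 by rewrite normc_ge0.
set B := expR (normc a / (1 - normc p)).
have inc n : normc (qprod a p n.+1 - qprod a p n) <= B * normc a * normc p ^+ n.
  rewrite /qprod big_nat_recr//= mulrBr mulr1 addrAC subrr add0r -mulrN normcM.
  rewrite -mulrA ler_pM ?normc_ge0 ?qprod_le//.
  by rewrite -mulNr normcM normcX -[in leLHS](mulN1r a) normcM normcN normc1 mul1r.
suff : cvgn (qprod a p : nat -> R[i]^o) by [].
by apply: cvg_complex; apply: (@cvg_geometric_increments _ _ (B * normc a) _ y01) => n;
  apply: le_trans (inc n); rewrite -raddfB ?normc_Re ?normc_Im.
Qed.

Lemma qpoch_unique a p (l : R[i]) :
  (qprod a p : nat -> R[i]^o) @ \oo --> (l : R[i]^o) -> qpoch a p = l.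
Proof. by move=> /cvg_lim; apply; exact: norm_hausdorff. Qed.

Lemma qprod_ge a p n : normc a / (1 - normc p) <= 1 / 2 -> normc p < 1 ->
  1 / 2 <= normc (qprod a p n).
Proof.
move=> ha p1; have y01 : 0 <= normc p < 1 by rewrite normc_ge0.
pose S n := \sum_(0 <= i < n) normc a * normc p ^+ i.
have S12 k : S k <= 1 / 2 by apply: le_trans ha; rewrite geometric_sum_le ?normc_ge0.
have S0 k : 0 <= S k.
  by apply: sumr_ge0 => i _; rewrite mulr_ge0 ?exprn_ge0 ?normc_ge0.
(* Weierstrass product inequality: [(1 - S) * (1 - x) >= 1 - S - x] for nonnegative [S] and [x]; the
   bound 1/2 on the sums keeps both factors positive. *)
suff h : 1 - S n <= normc (qprod a p n) by have := S12 n; lra.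
elim: n => [|n IH]; first by rewrite /S /qprod !big_nil normc1 subr0.
have := S12 n.+1; have := S0 n; rewrite /S /qprod !big_nat_recr//= -/(S n) -/(qprod a p n).
rewrite normcM.
have := normc_1B_ge (a * p ^+ n); rewrite normcM normcX.
have : 0 <= normc a * normc p ^+ n by rewrite mulr_ge0 ?exprn_ge0 ?normc_ge0.
move: (normc a * _) (normc (1 - _)) (normc (qprod a p n)) (S n) IH.
by move=> x w u s; nra.
Qed.

Lemma qpoch_shift a p s : normc p < 1 ->
  qpoch a p = qprod a p s * qpoch (a * p ^+ s) p.
Proof.
move=> p1; apply: qpoch_unique; rewrite -(cvg_shiftn s) /=.
rewrite (_ : (fun n => _) = (fun n => qprod a p s * qprod (a * p ^+ s) p n)).
  exact: (@cvgM _ _ _ _ (cst _) _ _ _ (cvg_cst _) (@cvg_qpoch (a * p ^+ s) p p1)).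
apply/funext => n.
rewrite /qprod (big_cat_nat (n := s))//= ?leq_addl//; congr (_ * _).
rewrite -{1}[s]add0n big_addn addnK; apply: eq_bigr => i _.
by rewrite -mulrA -exprD addnC.
Qed.

(* All but finitely many factors can be dropped, so that the remaining infinite
   product has modulus at least 1/2 by qprod_ge. *)
Lemma qpoch_neq0 a p : normc p < 1 ->
  (forall i, a * p ^+ i != 1) -> qpoch a p != 0.
Proof.
move=> p1 ap1; have y01 : 0 <= normc p < 1 by rewrite normc_ge0.
have [s hs] : exists s, normc (a * p ^+ s) / (1 - normc p) <= 1 / 2.
  have : geometric (normc a / (1 - normc p)) (normc p) @ \oo --> 0.
    by apply: cvg_geometric; rewrite ger0_norm ?normc_ge0.
  have h2 : 0 < 1 / 2 :> R by lra.
  move/cvgrPdist_le => /(_ _ h2) [s _ /(_ s (leqnn s))] /= hs; exists s.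
  apply: le_trans hs; rewrite sub0r normrN normcM normcX mulrAC.
  exact: ler_norm.
rewrite (qpoch_shift a p s p1) mulf_neq0//.
  by rewrite /qprod prodf_seq_neq0; apply/allP => i _ /=; rewrite subr_eq0 eq_sym.
apply/eqP => q0; have := @cvg_qpoch (a * p ^+ s) p p1; rewrite q0.
have h2 : 0 < (1 / 2)%:C :> R[i] by rewrite ltcR; lra.
move/cvgrPdist_lt => /(_ _ h2) [n _ /(_ n (leqnn n))] /=.
rewrite sub0r normrN normE ltcR; have := @qprod_ge _ p n hs p1; lra.
Qed.

(** The factors are sorted by their exponent modulo [d]. This is exact for partial products of
    length [n * d], and the limit is taken along that subsequence. *)
Lemma qpoch_split a p d : (0 < d)%N -> normc p < 1 ->
  \prod_(0 <= j < d) qpoch (a * p ^+ j) (p ^+ d) = qpoch a p.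
Proof.
move=> d0 p1; have pd1 := @normc_expr_lt1 R p d d0 p1.
have h1 := @cvg_prod R[i] nat (index_iota 0 d) _ _
  (fun j => @cvg_qpoch (a * p ^+ j) (p ^+ d) pd1).
have h2 : (fun n => qprod a p (n * d)%N) @ \oo --> (qpoch a p : R[i]^o).
  by have := @cvg_comp _ _ _ (muln^~ d) (qprod a p : nat -> R[i]^o) _ _ _ (cvg_mulnr _ d0) (@cvg_qpoch a p p1).
have h3 : (fun n => qprod a p (n * d)%N) =
    (fun n => \prod_(0 <= j < d) qprod (a * p ^+ j) (p ^+ d) n).
  apply/funext => n; rewrite /qprod big_nat_mul [RHS]exchange_big; apply: eq_bigr => i _ /=.
  rewrite -{1}[(i * d)%N]add0n mulSn big_addn addnK; apply: eq_bigr => j _.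
  by rewrite -mulrA -exprM -exprD mulnC.
by rewrite h3 in h2; apply: (cvg_unique _ h1 h2); exact: norm_hausdorff.
Qed.

(** * Euler products and the theta function *)

Lemma euler_neq0 (x : R[i]) : normc x < 1 -> qpoch x x != 0.
Proof.
move=> x1; apply: qpoch_neq0 => // i; rewrite -exprS; apply/eqP => /(congr1 (@normc R)).
by have := @normc_expr_lt1 R x i.+1 isT x1; rewrite normc1 => /lt_eqF/eqP.
Qed.

(** Splitting into even and odd exponents gives (x; x) = (x; x^2) (x^2; x^2), which eliminates (x;
    x^2) from the definition of psi. *)
Lemma rpsiE (x : R[i]) : normc x < 1 -> rpsi x = qpoch (x ^+ 2) (x ^+ 2) ^+ 2 / qpoch x x.
Proof.
move=> x1; have x21 := @normc_expr_lt1 R x 2 isT x1.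
rewrite -(@qpoch_split x x 2)// !big_nat_recr//= big_nil mul1r expr0 mulr1 expr1.
rewrite -expr2 invfM /rpsi [X in _ = X]mulrACA expr2 mulrA.
by rewrite -mulrA mulrC mulrA mulfK ?euler_neq0.
Qed.

(** This is [qpoch_split] for the base [r ^+ 2] and [d = M], since [r * (r ^+ 2) ^+ j] runs through
    the odd powers of [r]. *)
Lemma odd_qpoch_prod (r : R[i]) M : (0 < M)%N -> normc r < 1 ->
  \prod_(1 <= k < M.+1) qpoch (r ^+ (2 * k - 1)%N) (r ^+ (2 * M)%N) = qpoch r (r ^+ 2).
Proof.
move=> M0 r1; rewrite -(@qpoch_split r (r ^+ 2) M M0 (@normc_expr_lt1 R r 2 isT r1)).
rewrite big_add1/=; apply: eq_bigr => i _.
by rewrite -!exprM -exprS mulnS addSn subn1.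
Qed.

Lemma euler_psi_telescope (s : nat -> R[i]) n :
  (forall k, normc (s k) < 1) -> (forall k, s k.+1 ^+ 2 = s k) ->
  qpoch (s n) (s n) * \prod_(1 <= k < n.+1) rpsi (s k) ^+ (2 ^ (n - k))%N
  = qpoch (s 0%N) (s 0%N) ^+ (2 ^ n)%N.
Proof.
move=> s1 sS; rewrite -(square_quotient_telescope _ (fun k => qpoch (s k) (s k)) n); last first.
  by move=> k; apply: euler_neq0.
apply: (congr1 (GRing.mul (qpoch (s n) (s n)))); apply: eq_big_nat => k /andP[k1 _].
have skE : s k ^+ 2 = s k.-1 by rewrite -(sS k.-1) prednK.
by rewrite (rpsiE _ (s1 k)) skE.
Qed.

End Qpoch.

(** * The complex exponential and principal powers *)

Section ComplexExp.
Context {R : realType}.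
Implicit Types z w : R[i].

Lemma cexp0 : cexp 0 = 1 :> R[i].
Proof. by rewrite /cexp /= expR0 cos0 sin0 mulr1 mulr0. Qed.

Lemma cexpD z w : cexp (z + w) = cexp z * cexp w.
Proof.
case: z w => a b [c d]; rewrite /cexp /= expRD cosD sinD; simpc.
by congr (_ +i* _); ring.
Qed.

Lemma cexp_sum (I : Type) (r : seq I) (F : I -> R[i]) :
  cexp (\sum_(i <- r) F i) = \prod_(i <- r) cexp (F i).
Proof. exact: (big_morph _ cexpD cexp0). Qed.

Lemma cexpMn z n : cexp (z *+ n) = cexp z ^+ n.
Proof. by elim: n => [|n IH]; rewrite ?cexp0// mulrS cexpD IH exprS. Qed.

Lemma normc_cexp z : normc (cexp z) = expR (complex.Re z).
Proof.
rewrite /cexp /= !exprMn -mulrDr cos2Dsin2 mulr1 sqrtr_sqr.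
by rewrite ger0_norm ?expR_ge0.
Qed.

Lemma cexp_clog w : w != 0 -> cexp (clog w) = w.
Proof.
move=> w0; have n0 : 0 < normc w.
  by rewrite lt_def normc_ge0 andbT; apply: contra_neq w0 => /eq0_normc.
rewrite /cexp /clog /carg /= lnK ?posrE//.
have wI : -1 <= complex.Re w / normc w <= 1.
  rewrite -ler_norml normrM normfV (ger0_norm (ltW n0)) ler_pdivrMr// mul1r.
  exact: normc_Re.
(* [acos] takes values in [0, pi], where the sine is nonnegative, so only [|Im w|] is recovered; the
   case split in [carg] restores the sign. *)
have sinE : sin (acos (complex.Re w / normc w)) = `|complex.Im w| / normc w.
  rewrite sin_acos// -[X in _ = _ / X](ger0_norm (ltW n0)) -normf_div -sqrtr_sqr.
  congr Num.sqrt; have : normc w ^+ 2 = complex.Re w ^+ 2 + complex.Im w ^+ 2.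
    by case: w {w0 n0 wI} => a b; rewrite sqr_sqrtr ?addr_ge0 ?sqr_ge0.
  move: (gt_eqF n0); case: w {w0 n0 wI} => a b /= ; move: (Num.sqrt _) => n n0 nE.
  by rewrite !exprMn exprVn -[1](@mulfV _ (n ^+ 2)) ?sqrf_eq0 ?n0// -mulrBl nE addrAC subrr add0r.
have nn : normc w != 0 by rewrite gt_eqF.
case: ifPn => Iw; rewrite ?cosN ?sinN acosK ?in_itv// sinE.
  by rewrite ger0_norm// !mulrA ![normc w * _]mulrC !mulfK//; case: (w).
rewrite -ltNge in Iw; rewrite ltr0_norm// mulNr opprK.
by rewrite !mulrA ![normc w * _]mulrC !mulfK//; case: (w).
Qed.

Lemma prod_cpow (I : Type) (r : seq I) (F : I -> R[i]) w :
  \prod_(i <- r) cpow w (F i) = cpow w (\sum_(i <- r) F i).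
Proof. by rewrite /cpow mulr_suml cexp_sum. Qed.

Lemma cpow_nat w n : w != 0 -> cpow w n%:R = w ^+ n.
Proof. by move=> w0; rewrite /cpow mulr_natl cexpMn cexp_clog. Qed.

End ComplexExp.

(** * Odd indices and the exponent of 1 - q *)

(** As [m > 0], coprimality to [2 ^ m] is oddness; of the two indices added at each induction step
    only [2 * M + 1] survives. *)
Lemma prod_coprime_pow2 (A : comPzRingType) (F : nat -> A) M m : (0 < m)%N ->
  \prod_(1 <= k < (2 * M).+1 | coprime k (2 ^ m)) F k
  = \prod_(1 <= k < M.+1) F (2 * k - 1)%N.
Proof.
move=> m0; elim: M => [|M IH]; first by rewrite !big_nil.
rewrite [RHS]big_nat_recr//= -IH (_ : (2 * M.+1)%N = (2 * M).+2); last by rewrite mulnS.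
rewrite [LHS]big_mkcond/= [LHS]big_nat_recr//= [in LHS]big_nat_recr//= -big_mkcond/=.
have co k : coprime k (2 ^ m) = odd k by rewrite coprime_sym coprime_pexpl// coprime2n.
by rewrite !co/= !mul2n odd_double/= mulr1 subn1.
Qed.

(** The first [M] odd numbers add up to [M ^+ 2], so the sum is M - M^2 / (2M). *)
Lemma sum_odd_complement (A : numFieldType) (M : nat) : (0 < M)%N ->
  \sum_(1 <= k < M.+1) (1 - (2 * k%:R - 1) / (2 * M)%:R) = M%:R / 2 :> A.
Proof.
move=> M0; have sumE : \sum_(1 <= k < M.+1) (2 * k%:R - 1) = M%:R ^+ 2 :> A.
  elim: M {M0} => [|M IH]; first by rewrite big_nil expr0n.
  by rewrite big_nat_recr//= IH; ring.
have MN0 : M%:R != 0 :> A by rewrite pnatr_eq0 -lt0n.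
rewrite sumrB -mulr_suml sumE sumr_const_nat subn1/= natrM; field.
by rewrite MN0.
Qed.

(** * Assembling the product formula *)

Theorem theorem2p3 (R : realType) (tau : R[i]) (tau_gt0 : 0 < complex.Im tau)
    (m : nat) (m_gt1 : (1 < m)%N) :
  \prod_(1 <= k < (2 ^ (m - 1)).+1) qGamma tau ((2 * k%:R - 1) / 2 ^+ m)
  = (1 - nome tau) ^+ (2 ^ (m - 2))%N * rpsi (qpow tau (1 / 2 ^+ m))
    * \prod_(1 <= k < m) rpsi (qpow tau (1 / 2 ^+ k)) ^+ (2 ^ (m - 1 - k))%N
  /\
  \prod_(1 <= k < (2 ^ m).+1 | coprime k (2 ^ m)) qGamma tau (k%:R / 2 ^+ m)
  = \prod_(1 <= k < (2 ^ (m - 1)).+1) qGamma tau ((2 * k%:R - 1) / 2 ^+ m).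
Proof.
have m0 : (0 < m)%N by exact: ltnW.
(* Truncated subtraction on naturals agrees with subtraction in [R[i]] because [k >= 1]. *)
have oddE k : (1 <= k)%N -> (2 * k%:R - 1 : R[i]) = (2 * k - 1)%:R.
  by move=> k1; rewrite natrB ?natrM// muln_gt0.
have powE : (2 ^ m = 2 * 2 ^ (m - 1))%N by rewrite -expnS subn1 prednK.
split; last first.
  rewrite {1}powE prod_coprime_pow2//.
  by apply: eq_big_nat => k /andP[k1 _]; rewrite oddE.
(* [s k] is q^(1/2^k); defining all these roots through [tau] makes each the square of the next. *)
pose s k := qpow tau (1 / 2 ^+ k).
have two_neq0 k : (2 : R[i]) ^+ k != 0 by rewrite expf_neq0 ?pnatr_eq0.
have s0 : s 0%N = nome tau by rewrite /s /qpow /nome expr0 divr1 mulr1.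
have sS k : s k.+1 ^+ 2 = s k.
  rewrite /s /qpow -cexpMn -mulrnAr exprS; congr (cexp (_ * _)).
  by rewrite -mulr_natl; field; rewrite two_neq0.
have sX k j : qpow tau (j%:R / 2 ^+ k) = s k ^+ j.
  by rewrite /s /qpow -cexpMn -mulrnAr -mulrnAl.
(* The modulus of q is exp(-pi Im tau). *)
have nome_lt1 : normc (nome tau) < 1.
  rewrite normc_cexp -expR0 ltr_expR; case: tau tau_gt0 {s s0 sS sX} => a b /= b0.
  by have := pi_gt0 R; simpc; move=> p0; rewrite ?mul0r ?sub0r oppr_lt0 mulr_gt0.
have s1 k : normc (s k) < 1.
  elim: k => [|k IH]; first by rewrite s0.
  by move: IH; rewrite -sS normcX expr_lt1// normc_ge0.
have sE : s m ^+ (2 * 2 ^ (m - 1)) = nome tau.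
  by rewrite -powE -sX natrX divff// /nome /qpow mulr1.
set M := (2 ^ (m - 1))%N in powE sE *; have M0 : (0 < M)%N by rewrite expn_gt0.
have nome_neq1 : 1 - nome tau != 0.
  rewrite subr_eq0 eq_sym; apply/eqP => q1.
  by move: nome_lt1; rewrite q1 normc1 ltxx.
have poch_prod : \prod_(1 <= k < M.+1) qpoch (qpow tau ((2 * k%:R - 1) / 2 ^+ m)) (nome tau)
    = qpoch (s m) (s m ^+ 2).
  rewrite -(odd_qpoch_prod _ _ M0 (s1 m)) sE; apply: eq_big_nat => k /andP[k1 _].
  by rewrite oddE// sX.
have pow_prod : \prod_(1 <= k < M.+1) cpow (1 - nome tau) (1 - (2 * k%:R - 1) / 2 ^+ m)
    = (1 - nome tau) ^+ (2 ^ (m - 2))%N.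
  (* [m > 1] makes [M] even, so the total exponent [M / 2] is the natural number [2 ^ (m - 2)] and
     the principal power is an ordinary one. *)
  have mE : (m - 1)%N = (m - 2).+1 by rewrite subnSK.
  rewrite prod_cpow -natrX powE sum_odd_complement// -cpow_nat//; congr cpow.
  by rewrite /M mE expnS natrM mulrC mulKf// pnatr_eq0.
(* With [n = m - 1] the telescoped value is (q; q)^M, exactly the product of the [M] numerators of
   the q-gamma factors. *)
have psi_prod := euler_psi_telescope s (m - 1) s1 sS.
rewrite s0 -/M in psi_prod.
have mS : (m - 1).+1 = m by rewrite subn1 prednK.
rewrite mS in psi_prod.
have psiE : rpsi (s m) = qpoch (s (m - 1)%N) (s (m - 1)%N) / qpoch (s m) (s m ^+ 2).
  by rewrite /rpsi -(sS (m - 1)%N) mS.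
rewrite /qGamma big_split/= big_split/= prodfV poch_prod pow_prod.
rewrite prodr_const_nat subn1/= -psi_prod -/(s m) psiE.
(* Unless the limits are abstracted, unification unfolds them and becomes very slow. *)
move: (qpoch _ _) (qpoch _ _) (_ ^+ (2 ^ (m - 2))) (\prod_(_ <= _ < _) _) => a b c d.
ring.
Qed.
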